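(* For a positive integer $k$ let $\tau(k)$ denote the number of positive divisors of $k$, and for positive integers $n$ define $f'(n):=\sum_{1\le k\le n} 2^{\tau(k)}$. Then $$\lim_{n\to\infty} \frac{f'(2n)}{f'(n)}=\infty.$$
   Context: $\tau(k)$ is the number of positive divisors of $k$. *)

(* Defs.v *)
From mathcomp Require Import all_boot.

Set Implicit Arguments.
Unset Strict Implicit.
Unset Printing Implicit Defensive.

Definition tau (k : nat) : nat := size (divisors k).

Definition f' (n : nat) : nat := \sum_(1 <= k < n.+1) 2 ^ tau k.

(* Main.v *)
(** Choose [k <= n] with the most divisors among [1, ..., n] and write
    [k = 2 ^ a * r] with [r] odd. Then [tau (2 * k) - tau k = tau r], which is
    [tau k / (a + 1)], hence at least [tau k / (1 + log2 n)]. The numbers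
    [(2 * 3 * 5) ^ m] show that [tau k] grows at least like [(log2 n) ^ 3], so
    this gap eventually exceeds [1 + log2 n + c] for every constant [c]. Since
    [f' n <= n * 2 ^ tau k] and [f' (2 * n) >= 2 ^ tau (2 * k)], the ratio
    eventually exceeds [2 ^ c]. *)
Require Import Defs.
From mathcomp Require Import all_boot all_order all_algebra.
From mathcomp Require Import all_classical all_reals all_analysis.
From mathcomp Require Import zify.

Import Order.TTheory GRing.Theory Num.Theory.
Import numFieldNormedType.Exports.
Local Open Scope classical_set_scope.

(** Each divisor is [p ^ i * d] for a unique pair with [i <= a] and [d] dividing [r]: the [p]-adic
    valuation recovers [i], and then [p ^ i] cancels. *)
Lemma tau_prime_powM (p a r : nat) :
  prime p -> 0 < r -> ~~ (p %| r) -> tau (p ^ a * r) = a.+1 * tau r.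
Proof.
move=> p_pr r_gt0 pNr; have p_gt0 := prime_gt0 p_pr.
have pow_gt0 i : 0 < p ^ i by rewrite expn_gt0 p_gt0.
have pNdiv d : d \in divisors r -> ~~ (p %| d).
  rewrite -dvdn_divisors // => d_r; apply: contra pNr => p_d.
  exact: dvdn_trans p_d d_r.
have lognpM i d : d \in divisors r -> logn p (p ^ i * d) = i.
  move=> dr; have d_gt0 : 0 < d by move: dr; rewrite -dvdn_divisors // => /dvdn_gt0 ->.
  rewrite lognM // pfactorK // [logn p d](_ : _ = 0%N) ?addn0 //.
  by apply/eqP; rewrite -leqn0 leqNgt -pfactor_dvdn //= expn1 pNdiv.
rewrite /tau -[a.+1](size_iota 0) -(size_allpairs (fun i d => p ^ i * d)).
apply/perm_size/uniq_perm; first exact: divisors_uniq.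
- apply: allpairs_uniq; rewrite ?iota_uniq ?divisors_uniq // => -[i d] [j e].
  move=> /allpairsP[[i' d'] [_ d'_r [-> ->]]].
  move=> /allpairsP[[j' e'] /= [_ e'_r [-> ->]]] /= eq_prod.
  have eq_ij : i' = j' by rewrite -(lognpM i' d') // eq_prod lognpM.
  by move: eq_prod; rewrite eq_ij => /eqP; rewrite eqn_pmul2l // => /eqP ->.
move=> x; rewrite -dvdn_divisors ?muln_gt0 ?pow_gt0 //.
apply/idP/allpairsP => [x_dvd | [[i d] [i_le d_r ->]]].
  have x_gt0 : 0 < x by rewrite (dvdn_gt0 _ x_dvd) // muln_gt0 pow_gt0.
  have [d p_d x_eq] := pfactor_coprime p_pr x_gt0.
  exists (logn p x, d); split; last by rewrite mulnC.
    rewrite mem_iota /= add0n ltnS.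
    rewrite -[leqRHS](lognpM a r) ?divisors_id //.
    by apply: dvdn_leq_log x_dvd; rewrite muln_gt0 pow_gt0.
  rewrite /= -dvdn_divisors // -(@Gauss_dvdr _ (p ^ a)).
    by apply: dvdn_trans x_dvd; rewrite [X in _ %| X]x_eq dvdn_mulr.
  by rewrite coprime_sym coprimeXl.
move: i_le d_r; rewrite mem_iota /= add0n ltnS -dvdn_divisors // => i_le d_r.
by rewrite dvdn_mul // dvdn_exp2l.
Qed.

Lemma tau_30X (m : nat) : tau (30 ^ m) = m.+1 ^ 3.
Proof.
(* The trailing factor 1 lets [tau_prime_powM] split off [5 ^ m] as well. *)
have -> : 30 ^ m = 2 ^ m * (3 ^ m * (5 ^ m * 1)) by rewrite muln1 -!expnMn.
rewrite !tau_prime_powM ?muln_gt0 ?expn_gt0 //.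
- by rewrite -[tau 1]/1%N !expnS expn0.
- by rewrite !Euclid_dvdM // !Euclid_dvdX // negb_or /= ?andbF.
- by rewrite !Euclid_dvdM // !Euclid_dvdX // !negb_or /= ?andbF.
Qed.

Lemma f'_gt0 (n : nat) : 0 < n -> 0 < f' n.
Proof. by case: n => // n _; rewrite /f' big_nat_recr //= addn_gt0 expn_gt0 orbT. Qed.

Lemma tau_double_gap (k n : nat) : 0 < k <= n ->
  tau k <= (trunc_log 2 n).+1 * (tau (2 * k) - tau k).
Proof.
move=> /andP[k_gt0 le_kn]; have [r r_odd k_eq] := pfactor_coprime (isT : prime 2) k_gt0.
have two_r : ~~ (2 %| r) by rewrite -prime_coprime.
have r_gt0 : 0 < r by case: r two_r {r_odd k_eq}.
set a := logn 2 k in k_eq.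
have le_a : a <= trunc_log 2 n.
  apply: trunc_log_max => //; apply: leq_trans le_kn.
  by rewrite [leqRHS]k_eq leq_pmull.
have -> : tau (2 * k) = a.+2 * tau r.
  by rewrite [in LHS]k_eq [r * _]mulnC mulnA -expnS tau_prime_powM.
have -> : tau k = a.+1 * tau r by rewrite [in LHS]k_eq mulnC tau_prime_powM.
by rewrite -mulnBl subSnn mul1n leq_mul2r ltnS le_a orbT.
Qed.

(* [30 ^ m <= n] holds for [m = L %/ 5] since [30 <= 2 ^ 5]; the threshold makes
   [m + 1 >= 25 + 5 * c], whence [(m + 1) ^ 3 >= 5 * (m + 1) * (5 * (m + 1) + c)],
   which exceeds [(L + 1) * (L + 1 + c)]. Here [L] is [trunc_log 2 n]. *)
Lemma f'_double_ge (c n : nat) : 2 ^ (5 * (25 + 5 * c)) <= n ->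
  2 ^ c * f' n <= f' (2 * n).
Proof.
move=> le_n; have n_gt0 : 0 < n by apply: leq_trans le_n; rewrite expn_gt0.
set L := trunc_log 2 n.
have le_L : 5 * (25 + 5 * c) <= L by apply: trunc_log_max.
have lt_n : n < 2 ^ L.+1 by apply: trunc_log_ltn.
pose m := L %/ 5.
have le_30 : 30 ^ m <= n.
  apply: leq_trans (trunc_logP (isT : 1 < 2) n_gt0).
  apply: (@leq_trans (32 ^ m)); first by case: (m) => // i; rewrite leq_exp2r.
  by rewrite -[32]/(2 ^ 5) -expnM leq_exp2l // mulnC leq_divM.
(* The ordinals below [n.+1] include 0, which [P] excludes from the maximization. *)
pose P (i : 'I_n.+1) := 0 < i.
have [k k_gt0 kmax] := @arg_maxnP _ (@ord_max n) P (fun i => tau i) n_gt0.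
have tau_le j : 0 < j <= n -> tau j <= tau k.
  by move=> /andP[j_gt0 j_le]; apply: (kmax (Ordinal (j_le : j < n.+1))).
have k_le : 0 < k <= n by rewrite [0 < k]k_gt0 -ltnS ltn_ord.
have gap : L.+1 + c <= tau (2 * k) - tau k.
  have := tau_double_gap _ _ k_le; rewrite -/L.
  have := tau_le _ (introT andP (conj _ le_30)).
  rewrite expn_gt0 => /(_ isT); rewrite tau_30X => cube_le le_gap.
  rewrite -(@leq_pmul2l L.+1) //; apply: leq_trans le_gap.
  apply: leq_trans cube_le; rewrite /m.
  have := ltn_ceil L (isT : 0 < 5); rewrite -/m; clearbody m => lt_L.
  have m_ge : 25 + 5 * c <= m.+1 by lia.
  apply: (@leq_trans ((m.+1 * 5) * (m.+1 * 5 + c))).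
    by apply: leq_mul => //; rewrite leq_add2r.
  (* After cancelling [m.+1]: [25 * m.+1 + 5 * c <= (25 + 5 * c) * m.+1 <= m.+1 ^ 2]. *)
  rewrite expnS -mulnA leq_mul2l /= expnS expn1; nia.
have le_f'n : f' n <= n * 2 ^ tau k.
  rewrite /f' -[n in n * _](subn1 n.+1) -sum_nat_const_nat.
  rewrite big_nat_cond [leqRHS]big_nat_cond; apply: leq_sum => j.
  by rewrite andbT ltnS => /tau_le; rewrite leq_exp2l.
have le_f'2n : 2 ^ tau (2 * k) <= f' (2 * n).
  rewrite /f' (bigD1_seq (2 * k)) ?leq_addr ?iota_uniq //=.
  by rewrite mem_index_iota; lia.
apply: leq_trans le_f'2n.
(* The factor [2 ^ L.+1] absorbs [n]. By [gap] the truncated difference is positive, hence a true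
   one. *)
apply: (@leq_trans (2 ^ (c + L.+1 + tau k))); last by rewrite leq_exp2l //; lia.
rewrite !expnD -mulnA leq_mul2l; apply/orP; right.
by apply: leq_trans le_f'n _; rewrite leq_mul2r ltnW ?orbT.
Qed.

Local Open Scope ring_scope.

Theorem theorem1 (R : realType) :
  (fun n : nat => (f' (2 * n))%:R / (f' n)%:R : R) @ \oo --> +oo.
Proof.
apply/cvgryPge => A.
(* This gives [A <= c < 2 ^ c]; the absolute value is there because the Archimedean bound needs a
   nonnegative argument. *)
pose c := Num.bound `|A|.
exists (2 ^ (5 * (25 + 5 * c)))%N => // n /= le_n.
have n_gt0 : (0 < n)%N by apply: leq_trans le_n; rewrite expn_gt0.
rewrite ler_pdivlMr ?ltr0n ?f'_gt0 //.
have le_f' := f'_double_ge c n le_n.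
apply: le_trans (_ : (2 ^ c * f' n)%N%:R <= _); last by rewrite ler_nat.
rewrite natrM ler_wpM2r ?ler0n //.
apply: le_trans (ler_norm A) _; apply: le_trans (ltW (archi_boundP _)) _ => //.
by rewrite ler_nat; apply/ltnW/ltn_expl.
Qed.
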